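(* Let $\mathbf B^h\in W^h$ and $\hat{\mathbf B}^h\in\hat W^h$ satisfy $$\sum_e\int_{\Omega_e}q^h_m\,\nabla\cdot\mathbf B^h=0\quad\forall q^h_m\in Q^h_m,\qquad \sum_e\sum_i\int_{\Gamma_{e_i}}(\mathbf B^h-\hat{\mathbf B}^h)\cdot\mathbf n\,\hat q^h_m=0\quad\forall\hat q^h_m\in\hat Q^h_m .$$ Then $$\nabla\cdot\mathbf B^h=0\quad\forall\mathbf x\in\Omega_e\text{ and }\forall\Omega_e\in\mathcal T,$$ $$[\![\mathbf B^h]\!]=0\quad\forall\mathbf x\in F\text{ and }\forall F\in\mathcal F_{\rm int},$$ $$\mathbf B^h\cdot\mathbf n=\hat{\mathbf B}^h\cdot\mathbf n\quad\forall\mathbf x\in F\text{ and }\forall F\in\mathcal F_{\rm bdy}.$$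
   Context: $\Omega\subset\mathbb R^d$, $d\in\{2,3\}$, is a bounded domain. $\mathcal T=\{\Omega_e\}$ is a finite triangulation of $\Omega$ into simplices, $\bar\Omega=\overline{\cup_e\Omega_e}$; $\Gamma_{e_i}$ is the $i$-th facet of $\Omega_e$, and $\mathbf n$ on $\Gamma_{e_i}$ is the outward unit normal to $\Omega_e$. $\mathcal F$ is the set of all facets and $\tilde\Gamma=\overline{\cup_{F\in\mathcal F}F}$ the mesh skeleton. $\mathcal F_{\rm bdy}$ is the set of facets lying on $\partial\Omega$ and $\mathcal F_{\rm int}$ the set of the other facets; each $F\in\mathcal F_{\rm int}$ is shared by exactly two elements $\Omega_{e^+},\Omega_{e^-}$, with outward normals $\mathbf n^+,\mathbf n^-$ on $F$ ($\mathbf n^++\mathbf n^-=\mathbf 0$). The normal jump across $F$ is $[\![\mathbf y]\!]=\mathbf y^+\cdot\mathbf n^++\mathbf y^-\cdot\mathbf n^-$, $\mathbf y^\pm=\mathbf y|_{\Omega_{e^\pm}}$. $P_k(D)$ denotes polynomials of degree at most $k$ on $D$. For $k\ge1$: $W^h=\{\mathbf w\in[L^2(\Omega)]^d:\mathbf w|_{\Omega_e}\in[P_k(\Omega_e)]^d\ \forall\Omega_e\in\mathcal T\}$; $\hat W^h=\{\hat{\mathbf w}\in[L^2(\tilde\Gamma)]^d:\hat{\mathbf w}|_F\in[P_k(F)]^d\ \forall F\in\mathcal F\}$; $Q^h_m=\{q\in L^2(\Omega):q|_{\Omega_e}\in P_{k-1}(\Omega_e)\ \forall\Omega_e\in\mathcal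 T\}$; $\hat Q^h_m=\{\hat q\in L^2(\tilde\Gamma):\hat q|_F\in P_k(F)\ \forall F\in\mathcal F\}$. In integrals over $\Gamma_{e_i}$, $\mathbf B^h$ is evaluated from inside $\Omega_e$, while functions in $\hat W^h,\hat Q^h_m$ are single-valued on each facet.
   Formalization: Adds that each facet lying on ∂Ω belongs to exactly one element (Ω has no slits); on a slit facet shared by two elements the third conclusion fails, e.g. B^h = 0 with \hat B^h = n^+ on that facet and 0 on the others. *)

(* Defs.v *)
From HB Require Import structures.
From mathcomp Require Import all_boot all_order all_algebra.
From mathcomp Require mpoly.
From mathcomp Require Import all_classical all_reals all_analysis.
Set Implicit Arguments. Unset Strict Implicit. Unset Printing Implicit Defensive.
Import numFieldNormedType.Exports.
Import Order.TTheory GRing.Theory Num.Theory.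
Local Open Scope classical_set_scope.
Local Open Scope ring_scope.

(* 'rV[R]_n carries the sigma-algebra generated by its coordinates. *)
Section rV_measurable.
Context {R : realType} (n : nat).

Let coor : 'I_n -> 'rV[R]_n -> R := fun i x => x 0 i.

Let rV_measurable0 : g_sigma_preimage coor set0.
Proof. exact: sigma_algebra0. Qed.

Let rV_measurableC A : g_sigma_preimage coor A -> g_sigma_preimage coor (~` A).
Proof. exact: sigma_algebraC. Qed.

Let rV_measurable_bigcup (F : (set 'rV[R]_n)^nat) :
  (forall i, g_sigma_preimage coor (F i)) ->
  g_sigma_preimage coor (\bigcup_i F i).
Proof. exact: sigma_algebra_bigcup. Qed.

HB.instance Definition _ := @isMeasurable.Build default_measure_display
  'rV[R]_n (g_sigma_preimage coor) rV_measurable0 rV_measurableC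
  rV_measurable_bigcup.

Lemma measurable_coord (i : 'I_n) :
  measurable_fun [set: 'rV[R]_n] (fun x : 'rV[R]_n => x 0 i).
Proof.
move=> _ Y mY; rewrite setTI; apply: sub_sigma_algebra => /=.
rewrite -bigcup_seq/=; exists i => /=; first by rewrite mem_index_enum.
by exists Y => //; rewrite setTI.
Qed.

Lemma measurable_fun_coordP d (T : measurableType d) (f : T -> 'rV[R]_n) :
  (forall i, measurable_fun [set: T] (fun t => f t 0 i)) ->
  measurable_fun [set: T] f.
Proof.
move=> mf _ A mA; rewrite setTI.
have : [set B | measurable (f @^-1` B)] A; last by [].
move: A mA; apply: smallest_sub.
  split=> /=.
  - by rewrite preimage_set0.
  - by move=> B mB; rewrite setTD preimage_setC; exact: measurableC.
  - by move=> F mF; rewrite preimage_bigcup; exact: bigcup_measurable.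
rewrite -bigcup_seq; apply: bigcup_sub => i _ _ [B mB <-] /=.
by rewrite setTI -[X in measurable X]setTI; exact: (mf i).
Qed.

End rV_measurable.

Section lebesgue_rV.
Context {R : realType}.

Definition consrV n (p : measurableTypeR R * 'rV[R]_n) : 'rV[R]_n.+1 :=
  row_mx (p.1%:M : 'M[R]_1) p.2.

Lemma measurable_consrV n : measurable_fun setT (@consrV n).
Proof.
apply: measurable_fun_coordP => i; rewrite /consrV.
under eq_fun do rewrite mxE.
case: splitP => j _.
  under eq_fun do rewrite mxE (ord1 j) eqxx mulr1n.
  exact: measurable_fst.
apply: (measurableT_comp (measurable_coord j)); exact: measurable_snd.
Qed.

Section lebesgue_step.
Variables (n : nat) (mu : {sigma_finite_measure set ('rV[R]_n) -> \bar R}).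

Definition lebesgue_consrV : set 'rV[R]_n.+1 -> \bar R :=
  pushforward (lebesgue_measure \x mu)%E (@consrV n).

HB.instance Definition _ := Measure.copy lebesgue_consrV
  (@measure_function_pushforward__canonical__measure_function_Measure
     _ _ _ _ _ _ _ (@measurable_consrV n)).

Let lebesgue_consrV_sigma_finite : sigma_finite setT lebesgue_consrV.
Proof.
have /sigma_finiteP[F [TF ndF Foo]] := sigma_finiteT (@lebesgue_measure R).
have /sigma_finiteP[G [TG ndG Goo]] := sigma_finiteT mu.
have consrV0 (p : measurableTypeR R * 'rV[R]_n) : consrV p 0 0 = p.1.
  by rewrite mxE; case: splitP => // j _; rewrite mxE (ord1 j) eqxx mulr1n.
have consrVS (p : measurableTypeR R * 'rV[R]_n) :
    \row_j consrV p 0 (lift ord0 j) = p.2.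
  apply/rowP => i; rewrite !mxE.
  case: splitP => [[[]//]|j /eqP/=]; rewrite /bump leq0n eqSS => /eqP ij.
  by congr (p.2 _ _); apply/val_inj.
pose tl (x : 'rV[R]_n.+1) : 'rV[R]_n := \row_j x 0 (lift ord0 j).
have mtl : measurable_fun setT tl.
  apply: measurable_fun_coordP => i; rewrite /tl.
  under eq_fun do rewrite mxE.
  exact: measurable_coord.
exists (fun k => [set x : 'rV[R]_n.+1 | F k (x 0 0)] `&` tl @^-1` G k).
  apply/seteqP; split=> // x _.
  have [i _ Fi] : (\bigcup_k F k) (x 0 0) by rewrite -TF.
  have [j _ Gj] : (\bigcup_k G k) (tl x) by rewrite -TG.
  exists (maxn i j) => //; split => /=.
    by move: Fi; exact/subsetPset/ndF/leq_maxl.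
  by move: Gj; exact/subsetPset/ndG/leq_maxr.
move=> k; have [mF Fk] := Foo k; have [mG Gk] := Goo k; split.
  apply: measurableI.
    have := @measurable_coord R n.+1 0 measurableT (F k) mF.
    by rewrite setTI.
  by rewrite -[X in measurable X]setTI; exact: mtl.
rewrite /lebesgue_consrV /pushforward [X in (_ \x _)%E X](_ : _ = F k `*` G k).
  by rewrite product_measure1E// lte_mul_pinfty// ge0_fin_numE.
by apply/seteqP; split=> p /=; rewrite consrV0 /tl consrVS.
Qed.

HB.instance Definition _ := Measure_isSigmaFinite.Build _ _ _
  lebesgue_consrV lebesgue_consrV_sigma_finite.

End lebesgue_step.

(* Lebesgue measure on R^n (Borel sets), as the n-fold product of the
   one-dimensional one; on R^0 it is the unit mass at the only point. *)
Fixpoint lebesgue_rV n : {sigma_finite_measure set ('rV[R]_n) -> \bar R} :=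
  if n is m.+1 then lebesgue_consrV (lebesgue_rV m) else (\d_(0 : 'rV[R]_0)).

End lebesgue_rV.

Section calculus.
(* The notations of mpoly clash with those of MathComp-Analysis. *)
Import -(notations) mpoly.
Context {R : realType} {d : nat}.
Implicit Types (D : set 'rV[R]_d) (x u v : 'rV[R]_d).

Definition dot u v : R := \sum_i u 0 i * v 0 i.

Definition boundary D : set 'rV[R]_d := closure D `\` interior D.

Definition bounded_domain D : Prop :=
  [/\ D !=set0, open D, connected D & bounded_set D].

Definition divergence (w : 'rV[R]_d -> 'rV[R]_d) x : R :=
  \sum_i 'D_(delta_mx 0 i) (fun y => w y 0 i : R^o) x.

(* The value at [x], typically a point of the boundary of [D], of the
   continuous extension of the restriction of [w] to [D]. *)
Definition inner_trace D (w : 'rV[R]_d -> 'rV[R]_d) x : 'rV[R]_d :=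
  lim (w y @[y --> within D (nbhs x)]).

(* f belongs to P_k(D) *)
Definition poly_on (k : nat) D (f : 'rV[R]_d -> R) : Prop :=
  exists2 p : mpoly d R, (msize p <= k.+1)%N &
    forall x, D x -> f x = meval (fun i => x 0 i) p.

Definition square_integrable D (f : 'rV[R]_d -> R) : Prop :=
  measurable_fun D f /\
  (\int[lebesgue_rV d]_(x in D) (f x ^+ 2)%:E < +oo)%E.

End calculus.

Definition reference_simplex {R : realType} {m : nat} : set 'rV[R]_m :=
  [set t | (forall i, 0 < t 0 i) /\ \sum_i t 0 i < 1].

(* A mesh is given by a finite type [V] of vertex names, the vertex positions
   [pos], and the set [T] of its elements, a simplex being represented by the
   set of its vertices. *)
Section mesh.
Context {R : realType} {d : nat} {V : finType}.
Variable pos : V -> 'rV[R]_d.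
Implicit Types (S K F : {set V}) (v : V).

Definition affinely_independent S : Prop :=
  forall l : V -> R, \sum_(v in S) l v = 0 ->
    \sum_(v in S) l v *: pos v = 0 -> forall v, v \in S -> l v = 0.

Definition closed_simplex S : set 'rV[R]_d :=
  [set x | exists l : V -> R, [/\ forall v, v \in S -> 0 <= l v,
    \sum_(v in S) l v = 1 & x = \sum_(v in S) l v *: pos v]].

(* The relative interior of [closed_simplex S]. Elements and facets are
   relatively open: distinct facets are then disjoint, so that a function on
   the skeleton may be prescribed independently on each of them. *)
Definition open_simplex S : set 'rV[R]_d :=
  [set x | exists l : V -> R, [/\ forall v, v \in S -> 0 < l v,
    \sum_(v in S) l v = 1 & x = \sum_(v in S) l v *: pos v]].

(* The facets of the element [K] are the [K :\ v] for [v] in [K]. *)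
Definition facets (T : {set {set V}}) : {set {set V}} :=
  [set F : {set V} | [exists K in T, [exists v in K, F == K :\ v]]]%SET.

Definition on_boundary (Omega : set 'rV[R]_d) F : Prop :=
  open_simplex F `<=` boundary Omega.

Definition boundary_facet (Omega : set 'rV[R]_d) (T : {set {set V}}) F : Prop :=
  F \in facets T /\ on_boundary Omega F.

Definition interior_facet (Omega : set 'rV[R]_d) (T : {set {set V}}) F : Prop :=
  F \in facets T /\ ~ on_boundary Omega F.

(* Two closed elements meet exactly in the (possibly empty) face spanned by
   their common vertices; in particular distinct elements are disjoint.  The
   last condition says that Omega does not lie on both sides of a boundary
   facet (no slits). *)
Record triangulation (Omega : set 'rV[R]_d) (T : {set {set V}}) : Prop :=
  Triangulation {
    mesh_pos_inj : injective pos ;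
    mesh_card : forall K, K \in T -> #|K| = d.+1 ;
    mesh_nondegenerate : forall K, K \in T -> affinely_independent K ;
    mesh_sub : forall K, K \in T -> open_simplex K `<=` Omega ;
    mesh_cover :
      closure Omega = closure [set x | exists2 K, K \in T & open_simplex K x] ;
    mesh_conforming : forall K K', K \in T -> K' \in T ->
      closed_simplex K `&` closed_simplex K' = closed_simplex (K :&: K') ;
    mesh_interior_facet : forall F, interior_facet Omega T F ->
      #|[set K in T | F \subset K]%SET| = 2%N ;
    mesh_boundary_facet : forall F, boundary_facet Omega T F ->
      #|[set K in T | F \subset K]%SET| = 1%N }.

(* [n] is the unit normal, exterior to [K], on the facet opposite to [v]. *)
Definition outward_unit_normal K v (n : 'rV[R]_d) : Prop :=
  [/\ dot n n = 1,
      forall x y, open_simplex (K :\ v) x -> open_simplex (K :\ v) y ->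
        dot n (y - x) = 0
    & forall x y, open_simplex (K :\ v) x -> open_simplex K y ->
        dot n (y - x) < 0].

(* Surface integral over a facet [F] (with d vertices p_0, ..., p_(d-1)),
   through the affine parametrization t |-> p_0 + \sum_j t_j (p_(j+1) - p_0)
   by the reference simplex of R^(d-1); its area element is the square root
   of the Gram determinant; the order of the vertices is irrelevant. *)
Definition facet_points F : seq 'rV[R]_d := [seq pos v | v <- enum F].

Definition facet_edges F : 'M[R]_(d.-1, d) :=
  \matrix_(j < d.-1) ((facet_points F)`_j.+1 - (facet_points F)`_0).

Definition facet_param F (t : 'rV[R]_d.-1) : 'rV[R]_d :=
  (facet_points F)`_0 + t *m facet_edges F.

Definition facet_integral F (g : 'rV[R]_d -> R) : R :=
  Num.sqrt (\det (facet_edges F *m (facet_edges F)^T)) *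
  \int[lebesgue_rV d.-1]_(t in reference_simplex) g (facet_param F t).

Definition facet_square_integrable F (g : 'rV[R]_d -> R) : Prop :=
  square_integrable reference_simplex (g \o facet_param F).

Section spaces.
Variables (Omega : set 'rV[R]_d) (T : {set {set V}}) (k : nat).

(* Elements of L^2 are represented by functions that are polynomial everywhere
   on each open element (resp. facet).  The points outside the open facets
   form a null subset of the skeleton, so L^2 of the skeleton is L^2 of each
   facet. *)
Definition W_space (w : 'rV[R]_d -> 'rV[R]_d) : Prop := forall i : 'I_d,
  square_integrable Omega (fun x => w x 0 i) /\
  forall K, K \in T -> poly_on k (open_simplex K) (fun x => w x 0 i).

Definition What_space (w : 'rV[R]_d -> 'rV[R]_d) : Prop :=
  forall i : 'I_d, forall F, F \in facets T ->
  facet_square_integrable F (fun x => w x 0 i) /\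
  poly_on k (open_simplex F) (fun x => w x 0 i).

Definition Q_space (q : 'rV[R]_d -> R) : Prop :=
  square_integrable Omega q /\
  forall K, K \in T -> poly_on k.-1 (open_simplex K) q.

Definition Qhat_space (q : 'rV[R]_d -> R) : Prop :=
  forall F, F \in facets T ->
  facet_square_integrable F q /\ poly_on k (open_simplex F) q.

End spaces.

Definition element_trace K (w : 'rV[R]_d -> 'rV[R]_d) x : 'rV[R]_d :=
  inner_trace (open_simplex K) w x.

(* Jump at [x] across the common facet K :\ v = K' :\ v' of K and K'. *)
Definition normal_jump (n : {set V} -> V -> 'rV[R]_d)
    (w : 'rV[R]_d -> 'rV[R]_d) K v K' v' x : R :=
  dot (element_trace K w x) (n K v) + dot (element_trace K' w x) (n K' v').

End mesh.

(* Main.v *)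
Require Import Defs.
From HB Require Import structures.
From mathcomp Require Import all_boot all_order all_algebra.
From mathcomp Require mpoly polyrcf.
From mathcomp Require Import all_classical all_reals all_analysis.
From mathcomp Require Import measurable_realfun.
Set Implicit Arguments. Unset Strict Implicit. Unset Printing Implicit Defensive.
Import numFieldNormedType.Exports.
Import Order.TTheory GRing.Theory Num.Theory.
Local Open Scope classical_set_scope.
Local Open Scope ring_scope.

(* On an element the divergence of B is a polynomial of degree at most k - 1, so
   it may be used, extended by 0, as the test function q; the integral of its
   square over the element then vanishes.  On an interior facet the Bhat terms of
   the two adjacent elements cancel because the two outward normals are opposite,
   so testing with the polynomial jump of B, extended by 0 to the other facets,
   gives a vanishing integral of the square of the jump.  A boundary facet belongs
   to one element only, and there one tests with (B - Bhat).n. *)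

(** Testing yields vanishing integrals, while the conclusion is pointwise. The passage rests on one
    fact: a continuous, bounded, nonnegative function on a bounded open set whose integral is 0
    vanishes there, since otherwise it would exceed a positive constant on a cube of positive
    volume. On a facet this is applied in the parameter domain, so the parametrization has to reach
    the whole open facet and its area factor has to be nonzero. Three geometric facts do the rest.
    Open faces with different vertices are disjoint, by conformity and uniqueness of barycentric
    coordinates, so an extension by 0 stays polynomial on every other element or facet. The trace of
    [B] is the value of its polynomial, because a facet point is a limit of points of the element.
    The normals are known only through length, orthogonality and sign; that those of two neighbours
    are opposite has to be proved. *)

Section polynomials.
Import -(notations) mpoly.
Context {R : realType} {d : nat}.
Implicit Types (p q : mpoly d R) (x v : 'rV[R]_d).

(** Constants and variables generate the ring, so continuity, measurability, boundedness and
    differentiation of [polyfun] reduce to generators, sums and products. *)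
Lemma mpoly_gen_ind (P : mpoly d R -> Prop) :
  (forall c, P (mpolyC d c)) -> (forall i, P (mpolyX R (mnm1 i))) ->
  (forall p q, P p -> P q -> P (p + q)) ->
  (forall p q, P p -> P q -> P (p * q)) -> forall p, P p.
Proof.
move=> PC PX PD PM p; rewrite (mpolyE p).
have P0 : P 0 by rewrite -(mpolyC0 d R).
apply: big_ind => // m _; rewrite -mul_mpolyC; apply: (PM) => //.
have P1 : P 1 by rewrite -(mpolyC1 d R).
rewrite mpolyXE_id; apply: big_ind => // i _.
by elim: (m i) => [|k IH]; rewrite ?expr0 // exprS; apply: PM.
Qed.

Definition polyfun p x : R := meval (fun i => x 0 i) p.

Lemma polyfunC c : polyfun (mpolyC d c) = cst c.
Proof. by apply/funext => x; rewrite /polyfun mevalC. Qed.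

Lemma polyfunX i : polyfun (mpolyX R (mnm1 i)) = fun x => x 0 i.
Proof. by apply/funext => x; rewrite /polyfun mevalXU. Qed.

Lemma polyfunD p q : polyfun (p + q) = fun x => polyfun p x + polyfun q x.
Proof. by apply/funext => x; rewrite /polyfun mevalD. Qed.

Lemma polyfunM p q : polyfun (p * q) = fun x => polyfun p x * polyfun q x.
Proof. by apply/funext => x; rewrite /polyfun mevalM. Qed.

Lemma polyfunZ c p : polyfun (c *: p) = fun x => c * polyfun p x.
Proof. by apply/funext => x; rewrite /polyfun mevalZ. Qed.

Lemma polyfun_sum I (r : seq I) (P : pred I) (F : I -> mpoly d R) x :
  polyfun (\sum_(i <- r | P i) F i) x = \sum_(i <- r | P i) polyfun (F i) x.
Proof. by rewrite /polyfun raddf_sum. Qed.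

Lemma continuous_polyfun p : continuous (polyfun p).
Proof.
elim/mpoly_gen_ind: p => [c|i|p q Pp Pq|p q Pp Pq] x.
- by rewrite polyfunC; exact: (@cst_continuous _ _ c x).
- by rewrite polyfunX; apply: coord_continuous.
- by rewrite polyfunD; exact: (continuousD (Pp x) (Pq x)).
- by rewrite polyfunM; exact: (continuousM (Pp x) (Pq x)).
Qed.

Lemma measurable_polyfun p : measurable_fun [set: 'rV[R]_d] (polyfun p).
Proof.
elim/mpoly_gen_ind: p => [c|i|p q Pp Pq|p q Pp Pq].
- by rewrite polyfunC; exact: measurable_cst.
- by rewrite polyfunX; exact: measurable_coord.
- by rewrite polyfunD; apply: measurable_funD.
- by rewrite polyfunM; apply: measurable_funM.
Qed.

Lemma polyfun_bounded (M : R) p :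
  exists C, forall x, (forall i, `|x 0 i| <= M) -> `|polyfun p x| <= C.
Proof.
elim/mpoly_gen_ind: p => [c|i|p q [C HC] [C' HC']|p q [C HC] [C' HC']].
- by exists `|c| => x _; rewrite polyfunC.
- by exists M => x; rewrite polyfunX.
- exists (C + C') => x xM; rewrite polyfunD (le_trans (ler_normD _ _)) //.
  by rewrite lerD ?HC ?HC'.
- by exists (C * C') => x xM; rewrite polyfunM normrM ler_pM ?HC ?HC'.
Qed.

Lemma is_derive_coord v x (j : 'I_d) :
  is_derive x v (fun y : 'rV[R]_d => y 0 j : R^o) (v 0 j).
Proof.
pose f (y : 'rV[R]_d) : R^o := y 0 j.
have lf : linear f by move=> a y z; rewrite /f !mxE.
pose fM := GRing.isLinear.Build _ _ _ _ _ lf.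
pose fL : {linear 'rV[R]_d -> R^o} := HB.pack f fM.
have cf : continuous fL by exact: coord_continuous.
apply: DeriveDef; first exact/diff_derivable/differentiable_coord.
by rewrite deriveE ?(diff_lin x cf) //; exact: differentiable_coord.
Qed.

Lemma is_derive_polyfun p (i : 'I_d) x :
  is_derive x (delta_mx 0 i) (polyfun p : _ -> R^o) (polyfun (mderiv i p) x).
Proof.
elim/mpoly_gen_ind: p => [c|j|p q Pp Pq|p q Pp Pq].
- by rewrite mderivC polyfunC -(mpolyC0 d R) polyfunC; exact: is_derive_cst.
- rewrite polyfunX mderivX polyfunZ /polyfun mnm1E.
  apply: (is_derive_eq (is_derive_coord _ _ _)); rewrite mxE /= eq_sym.
  have [->|_] := eqVneq j i; last by rewrite mul0r.
  by rewrite (_ : mnm_sub _ _ = mnm0) ?mpolyX0 ?mevalC ?mulr1 //; apply/mnmP => l;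
  rewrite mnmBE mnm0E subnn.
- by rewrite mderivD !polyfunD; exact: (is_deriveD Pp Pq).
- rewrite mderivM polyfunD !polyfunM.
  apply: (is_derive_eq (is_deriveM Pp Pq)).
  by rewrite /GRing.scale /= addrC mulrC.
Qed.

(** A monomial [m] of the derivative comes from [m] plus [mnm1 i] in the support of [p], whose
    degree is one higher. *)
Lemma msize_mderiv (i : 'I_d) k p :
  (msize p <= k.+1)%N -> (msize (mderiv i p) <= k)%N.
Proof.
move=> pk; rewrite msizeE; apply/bigmax_leqP_seq => m.
rewrite mcoeff_msupp mcoeff_deriv => pm _.
have /msize_mdeg_lt : (mnm_add m (mnm1 i)) \in msupp p.
  by rewrite mcoeff_msupp; apply: contraNneq pm => ->; rewrite mul0rn.
by rewrite mdegD mdeg1 addn1 => /leq_trans/(_ pk).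
Qed.

End polynomials.

(** * Volume of cubes, and nonnegative functions with zero integral *)

Section integration.
Context {R : realType}.

(** Plain coordinate inequalities split as a product along [consrV]; in dimension 0 a box is the
    whole space. *)
Definition box n (c : 'rV[R]_n) (r : R) : set 'rV[R]_n :=
  [set x | forall i, `|c 0 i - x 0 i| < r].

Lemma boxS n (c : 'rV[R]_n.+1) r :
  @consrV R n @^-1` box c r =
  ball (c 0 0 : R) r `*` box (\row_j c 0 (lift ord0 j)) r.
Proof.
apply/seteqP; split=> [[a x]|[a x]] /=.
  move=> cax; split.
    move: (cax 0); rewrite /consrV mxE; case: splitP => // j _.
    by rewrite mxE (ord1 j) eqxx mulr1n.
  move=> j; move: (cax (lift ord0 j)); rewrite /consrV !mxE; case: splitP.
    by move=> [[]].
  by move=> i; rewrite /= /bump leq0n add1n => -[/val_inj ->].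
move=> [ca cx] i; rewrite /consrV mxE; case: splitP => j ij.
  rewrite mxE (ord1 j) eqxx mulr1n.
  by rewrite (_ : i = 0) //; apply/val_inj; rewrite /= ij (ord1 j).
move: (cx j); rewrite mxE (_ : lift ord0 j = i) //.
by apply/val_inj; rewrite /= ij.
Qed.

Lemma measurable_box n (c : 'rV[R]_n) r : measurable (box c r).
Proof.
rewrite (_ : box c r = \big[setI/setT]_i
   ((fun x : 'rV[R]_n => x 0 i) @^-1` ball (c 0 i : R) r)).
  apply: bigsetI_measurable => i _; rewrite -[X in measurable X]setTI.
  by apply: measurable_coord => //; exact: measurable_ball.
rewrite -bigcap_seq; apply/seteqP; split=> x /=.
  by move=> cx i _; exact: cx.
by move=> cx i; apply: cx; rewrite /= mem_index_enum.
Qed.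

(** By induction on the dimension: a box is an interval of length [2 r] times a box of one dimension
    less, and the empty product matches the unit mass on R^0. *)
Lemma lebesgue_box n (c : 'rV[R]_n) r : 0 <= r ->
  lebesgue_rV n (box c r) = ((r *+ 2) ^+ n)%:E.
Proof.
move=> r0; elim: n c => [|n IH] c.
  by rewrite /= diracE mem_set // => -[].
rewrite [LHS](_ : _ = (lebesgue_measure \x lebesgue_rV n)%E
  (@consrV R n @^-1` box c r)) // boxS product_measure1E.
- by rewrite IH exprS EFinM; congr (_ * _)%E; exact: lebesgue_measure_ball.
- exact: measurable_ball.
- exact: measurable_box.
Qed.

Lemma box_nbhs n (c : 'rV[R]_n) (A : set 'rV[R]_n) : nbhs c A ->
  exists2 r, 0 < r & box c r `<=` A.
Proof.
move=> /nbhs_ballP[e e0 eA]; exists e => // x cx; apply: eA; split=> // i j.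
by rewrite (ord1 i); exact: cx.
Qed.

Lemma integrable_bounded n (D : set 'rV[R]_n) (f : 'rV[R]_n -> R) M C :
  measurable D -> D `<=` box 0 M -> measurable_fun D f ->
  (forall x, D x -> `|f x| <= C) ->
  (lebesgue_rV n).-integrable D (EFin \o f).
Proof.
move=> mD DM mf fC; apply: measurable_bounded_integrable => //.
  (* [M] carries no sign, while the volume formula needs a nonnegative radius. *)
  have DM' : D `<=` box 0 `|M|.
    by move=> x /DM xM i; exact: (lt_le_trans (xM i) (ler_norm M)).
  apply: le_lt_trans (ltry ((`|M| *+ 2) ^+ n)).
  rewrite -(lebesgue_box 0 (normr_ge0 M)).
  by apply: le_measure DM'; rewrite inE //; exact: measurable_box.
exists C; split; first exact: num_real.
by move=> y Cy x /= /fC /le_trans; apply; exact: ltW.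
Qed.

(** If [f x] were positive, continuity would keep [f] above [f x / 2] on a small box inside [D], and
    the integral would be at least [f x / 2] times the volume of that box. The bound [C] gives
    integrability: the real-valued integral sends an infinite value to 0, so its vanishing would
    otherwise be inconclusive. *)
Lemma Rintegral_ge0_eq0 n (D : set 'rV[R]_n) (f : 'rV[R]_n -> R) M C :
  open D -> measurable D -> D `<=` box 0 M -> measurable_fun D f ->
  (forall x, D x -> 0 <= f x <= C) ->
  (forall x, D x -> {for x, continuous f}) ->
  \int[lebesgue_rV n]_(x in D) f x = 0 -> forall x, D x -> f x = 0.
Proof.
move=> oD mD DM mf fC cf int0 x Dx.
have f0 y : D y -> 0 <= f y by move=> /fC/andP[].
apply/eqP; rewrite eq_le f0 // andbT leNgt; apply/negP => fx0.
have intf : (lebesgue_rV n).-integrable D (EFin \o f).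
  apply: (integrable_bounded (C := C) mD DM mf) => y Dy.
  by rewrite ger0_norm ?f0 //; case/andP: (fC _ Dy).
have [r r0 rD] : exists2 r, 0 < r & box x r `<=` D `&` [set y | f x / 2 < f y].
  apply: box_nbhs; apply: filterI; first exact: open_nbhs_nbhs.
  have fx2 : f x / 2 < f x by rewrite ltr_pdivrMr // ltr_pMr // ltr1n.
  exact: (cf x Dx [set z | f x / 2 < z] (lt_nbhsr fx2)).
suff : ((f x / 2 * (r *+ 2) ^+ n)%:E <= \int[lebesgue_rV n]_(x in D) (f x)%:E)%E.
  have /fineK <- := integrable_fin_num mD intf.
  rewrite -/(Rintegral _ _ _) int0 lee_fin leNgt => /negP; apply.
  by rewrite mulr_gt0 ?divr_gt0 // exprn_gt0 // mulrn_wgt0.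
rewrite EFinM -(lebesgue_box x (ltW r0)) -integral_cst; last exact: measurable_box.
apply: (@le_trans _ _ (\int[lebesgue_rV n]_(x in box x r) (f x)%:E)%E).
  apply: ge0_le_integral => //.
  - exact: measurable_box.
  - by move=> y _; rewrite lee_fin divr_ge0 // ltW.
  - apply/measurable_EFinP; apply: measurable_funS mf => //.
    by move=> y /rD[].
  - by move=> y /rD[_ /ltW]; rewrite lee_fin.
apply: ge0_subset_integral => //.
- exact: measurable_box.
- exact/measurable_EFinP.
- by move=> y /rD[].
Qed.

End integration.

(** Weights on a face, extended by 0, become weights on the element, where uniqueness of barycentric
    coordinates can compare them. *)
Lemma sum_restrict {W : nmodType} {V : finType} (S K : {set V}) (F : V -> W) :
  S \subset K -> \sum_(v in K) (if v \in S then F v else 0) = \sum_(v in S) F v.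
Proof.
move=> SK; rewrite [RHS]big_mkcond [LHS]big_mkcond; apply: eq_bigr => v _.
have [vS|_] := boolP (v \in S); last by rewrite if_same.
by have /= -> := fintype.subsetP SK v vS.
Qed.

Lemma sum_restrictZ {R : pzRingType} {W : lmodType R} {V : finType}
    (S K : {set V}) (l : V -> R) (F : V -> W) : S \subset K ->
  \sum_(v in K) (if v \in S then l v else 0) *: F v = \sum_(v in S) l v *: F v.
Proof.
move=> SK; rewrite -(sum_restrict _ SK); apply: eq_bigr => v _.
by case: ifP => // _; rewrite scale0r.
Qed.

Section dot.
Context {R : realType} {d : nat}.
Implicit Types (u v w : 'rV[R]_d).

Lemma dotDl u v w : dot (u + v) w = dot u w + dot v w.
Proof. by rewrite /dot -big_split; apply: eq_bigr => i _; rewrite mxE mulrDl. Qed.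

Lemma dotC u v : dot u v = dot v u.
Proof. by apply: eq_bigr => i _; rewrite mulrC. Qed.

Lemma dotZl a u v : dot (a *: u) v = a * dot u v.
Proof. by rewrite /dot mulr_sumr; apply: eq_bigr => i _; rewrite mxE mulrA. Qed.

Lemma dotNl u v : dot (- u) v = - dot u v.
Proof. by rewrite -scaleN1r dotZl mulN1r. Qed.

Lemma dotDr u v w : dot u (v + w) = dot u v + dot u w.
Proof. by rewrite dotC dotDl !(dotC u). Qed.

Lemma dotZr a u v : dot u (a *: v) = a * dot u v.
Proof. by rewrite dotC dotZl dotC. Qed.

Lemma dotNr u v : dot u (- v) = - dot u v.
Proof. by rewrite dotC dotNl dotC. Qed.

Lemma dot_sumr I (r : seq I) (P : pred I) u (F : I -> 'rV[R]_d) :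
  dot u (\sum_(i <- r | P i) F i) = \sum_(i <- r | P i) dot u (F i).
Proof.
apply: (big_morph (dot u)) => [x y|]; first exact: dotDr.
by rewrite -(scale0r 0) dotZr mul0r.
Qed.

Lemma dot_ge0 u : 0 <= dot u u.
Proof. by apply: sumr_ge0 => i _; rewrite -expr2 sqr_ge0. Qed.

Lemma dot_eq0 u : dot u u = 0 -> u = 0.
Proof.
move=> /eqP; rewrite /dot psumr_eq0 => [/allP u0|i _]; last first.
  by rewrite -expr2 sqr_ge0.
apply/rowP => i; rewrite mxE; apply/eqP.
by have := u0 i (mem_index_enum _); rewrite mulf_eq0 orbb.
Qed.

End dot.

Lemma continuous_rV {R : realType} {m n : nat} (f : 'rV[R]_m -> 'rV[R]_n) t :
  (forall i, {for t, continuous (fun s => f s 0 i)}) -> {for t, continuous f}.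
Proof.
move=> cf A /box_nbhs[r r0 rA].
apply: (@filterS _ (nbhs t) _ [set s | forall i, `|f t 0 i - f s 0 i| < r]).
  by move=> s ts; exact: rA.
apply: (@filter_forall _ _ (fun i s => `|f t 0 i - f s 0 i| < r) _ (nbhs_filter t)) => i.
exact: (cf i _ (@nbhsx_ballx _ R (f t 0 i) r r0)).
Qed.

(** Serves to push a facet point slightly into an element; [e <= 1] keeps the new point on the
    segment towards [u], where convexity applies. *)
Lemma segment_nbhs {R : realType} {n : nat} (x u : 'rV[R]_n) (A : set 'rV[R]_n) :
  nbhs x A -> exists2 e : R, 0 < e <= 1 & A (x + e *: (u - x)).
Proof.
move=> /box_nbhs[r r0 rA].
(* [s] bounds every coordinate of [u - x] and, being at least 1, may be divided by even when
   [u = x]. The half of [r] below makes the last inequality strict. *)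
pose s := 1 + \sum_i `|(u - x) 0 i|.
have s1 : 1 <= s by rewrite lerDl sumr_ge0.
have s0 : 0 < s by exact: lt_le_trans s1.
exists (Num.min 1 (r / 2 / s)).
  by rewrite lt_min ltr01 !divr_gt0 //= ge_min lexx.
apply: rA => i; rewrite !mxE opprD addrA subrr sub0r normrN normrM.
have lei : `|(u - x) 0 i| <= s.
  by rewrite /s (bigD1 i) //= addrCA lerDl addr_ge0 // sumr_ge0.
rewrite gtr0_norm ?lt_min ?ltr01 ?divr_gt0 //.
apply: (@le_lt_trans _ _ (r / 2 / s * s)).
  rewrite ler_pM //; [by rewrite le_min ler01 !divr_ge0 // ltW| |].
    by rewrite ge_min lexx orbT.
  by move: lei; rewrite !mxE.
by rewrite divfK ?gt_eqF // ltr_pdivrMr // ltr_pMr // ltr1n.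
Qed.

(** * Barycentric coordinates, disjointness, openness and measurability of simplices *)

Section simplices.
Import -(notations) mpoly.
Context {R : realType} {d : nat} {V : finType} (pos : V -> 'rV[R]_d).
Implicit Types (S K : {set V}) (v w : V) (x y u : 'rV[R]_d).

Lemma affinely_independent_sub S K :
  S \subset K -> affinely_independent pos K -> affinely_independent pos S.
Proof.
move=> SK indK l l0 lp0 v vS.
have := indK (fun v => if v \in S then l v else 0) _ _ v (fintype.subsetP SK _ vS).
rewrite vS; apply; last by rewrite sum_restrictZ.
by rewrite sum_restrict.
Qed.

Lemma barycentric_unique K (l l' : V -> R) : affinely_independent pos K ->
  \sum_(v in K) l v = \sum_(v in K) l' v ->
  \sum_(v in K) l v *: pos v = \sum_(v in K) l' v *: pos v ->
  forall v, v \in K -> l v = l' v.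
Proof.
move=> indK sl spl v vK; apply/eqP; rewrite -subr_eq0; apply/eqP.
apply: (indK (fun v => l v - l' v)) => //; first by rewrite sumrB sl subrr.
by under eq_bigr do rewrite scalerBl; rewrite sumrB spl subrr.
Qed.

Lemma open_simplex_closed S x : open_simplex pos S x -> closed_simplex pos S x.
Proof. by move=> [l [l0 l1 ->]]; exists l; split=> // v /l0/ltW. Qed.

Lemma closed_simplex_sub S K :
  S \subset K -> closed_simplex pos S `<=` closed_simplex pos K.
Proof.
move=> SK x [l [l0 l1 ->]]; exists (fun v => if v \in S then l v else 0).
split; [|by rewrite sum_restrict|by rewrite sum_restrictZ].
by move=> v vK; case: ifP => // /l0.
Qed.

Lemma open_simplex_nonempty S : (0 < #|S|)%N -> open_simplex pos S !=set0.
Proof.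
move=> S0; exists (\sum_(v in S) (#|S|%:R : R)^-1 *: pos v).
exists (fun=> #|S|%:R^-1); split=> //; first by rewrite invr_gt0 ltr0n.
by rewrite sumr_const -[LHS]mulr_natr mulVf // pnatr_eq0 -lt0n.
Qed.

(** The weights [(1 - e) * l v + e * m v] are positive even where [l v] vanishes, because [e] and
    [m v] are positive. *)
Lemma open_simplex_segment K x u (e : R) : closed_simplex pos K x ->
  open_simplex pos K u -> 0 < e <= 1 -> open_simplex pos K (x + e *: (u - x)).
Proof.
move=> [l [l0 l1 ->]] [m [m0 m1 ->]] /andP[e0 e1].
exists (fun v => (1 - e) * l v + e * m v); split.
- move=> v vK; rewrite ltr_wpDl ?mulr_gt0 ?m0 // mulr_ge0 ?l0 //.
  by rewrite subr_ge0.
- by rewrite big_split /= -!mulr_sumr l1 m1 !mulr1 subrK.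
- under [RHS]eq_bigr do rewrite scalerDl -!scalerA.
  rewrite big_split /= -!scaler_sumr scalerBl scale1r scalerBr.
  by rewrite addrA addrAC.
Qed.

Lemma open_simplex_closure S K x : S \subset K -> (0 < #|K|)%N ->
  open_simplex pos S x -> closure (open_simplex pos K) x.
Proof.
move=> SK /open_simplex_nonempty[u Ku] Sx A /(segment_nbhs u)[e e01 Ae].
exists (x + e *: (u - x)); split=> //; apply: open_simplex_segment => //.
exact: closed_simplex_sub SK _ (open_simplex_closed Sx).
Qed.

(** The point has only one family of barycentric coordinates in [K]: read off from [S] they are
    positive on [S], read off from [S'] they vanish outside [S']. *)
Lemma open_simplex_subset K S S' x : affinely_independent pos K ->
  S \subset K -> S' \subset K ->
  open_simplex pos S x -> closed_simplex pos S' x -> S \subset S'.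
Proof.
move=> indK SK S'K [l [l0 l1 xl]] [m [_ m1 xm]]; apply/fintype.subsetP => v vS.
have vK := fintype.subsetP SK _ vS.
have := @barycentric_unique K (fun v => if v \in S then l v else 0)
  (fun v => if v \in S' then m v else 0) indK.
rewrite !sum_restrict // !sum_restrictZ // l1 m1 -xl -xm => /(_ erefl erefl v vK).
rewrite vS; case: ifP => // _ lv0.
by have := l0 v vS; rewrite lv0 ltxx.
Qed.

(** Conformity puts the common point in the closed face spanned by [K :&: K'], which forces [S']
    into [K]. Both faces then belong to one element, where barycentric coordinates decide. *)
Lemma open_simplex_inj (Omega : set 'rV[R]_d) (T : {set {set V}}) K K' S S' x :
  triangulation pos Omega T -> K \in T -> K' \in T ->
  S \subset K -> S' \subset K' ->
  open_simplex pos S x -> open_simplex pos S' x -> S = S'.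
Proof.
move=> hT KT K'T SK S'K' Sx S'x.
have indK := mesh_nondegenerate hT KT.
have indK' := mesh_nondegenerate hT K'T.
have KK'x : closed_simplex pos (K :&: K') x.
  rewrite -(mesh_conforming hT KT K'T); split.
    exact: closed_simplex_sub SK _ (open_simplex_closed Sx).
  exact: closed_simplex_sub S'K' _ (open_simplex_closed S'x).
have S'K : S' \subset K.
  apply: fintype.subset_trans (finset.subsetIl K K').
  by apply: (open_simplex_subset indK' S'K') S'x KK'x; exact: finset.subsetIr.
apply/eqP; rewrite finset.eqEsubset.
apply/andP; split.
  exact: open_simplex_subset indK SK S'K Sx (open_simplex_closed S'x).
exact: open_simplex_subset indK S'K SK S'x (open_simplex_closed Sx).
Qed.

(** The rows [(1, pos v)] form a matrix [M] with as many rows as columns, free by affine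
    independence. The coefficients of [(1, x)] in these rows are affine in [x], and the column of
    ones makes them sum to 1. *)
Lemma barycentric_coordinates K : #|K| = d.+1 -> affinely_independent pos K ->
  exists lam : V -> mpoly d R, forall x,
    \sum_(v in K) polyfun (lam v) x = 1 /\
    x = \sum_(v in K) polyfun (lam v) x *: pos v.
Proof.
move=> cK indK.
have /card_gt0P[v0 v0K] : (0 < #|K|)%N by rewrite cK.
pose M : 'M[R]_(#|K|, 1 + d) :=
  \matrix_(i < #|K|) row_mx (1%:M : 'M[R]_1) (pos (enum_val i)).
have ML i : M i (lshift d 0) = 1 by rewrite mxE row_mxEl mxE eqxx.
have MR i k : M i (rshift 1 k) = pos (enum_val i) 0 k by rewrite mxE row_mxEr.
have Mfree : row_free M.
  apply: inj_row_free => u uM; apply/rowP => i; rewrite mxE.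
  pose l v := u 0 (enum_rank_in v0K v).
  have lE j : l (enum_val j) = u 0 j by rewrite /l enum_valK_in.
  have uMj j : \sum_i u 0 i * M i j = 0.
    by move/rowP/(_ j): uM; rewrite !mxE.
  rewrite -lE; apply: indK (enum_valP i).
    rewrite big_enum_val; under eq_bigr do rewrite lE.
    rewrite -[RHS](uMj (lshift d 0)); apply: eq_bigr => j _.
    by rewrite ML mulr1.
  rewrite big_enum_val; under eq_bigr do rewrite lE.
  apply/rowP => k; rewrite mxE -[RHS](uMj (rshift 1 k)) summxE.
  by apply: eq_bigr => j _; rewrite mxE MR.
have Mfull : row_full M.
  by move: Mfree; rewrite /row_free /row_full => /eqP ->; rewrite cK.
(* [#|K|] and [1 + d] are equal only by a proof, so [M] is not of a square matrix type and the
   pseudo-inverse stands in for [invmx]. *)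
pose P := pinvmx M.
pose lam v : mpoly d R := let i := enum_rank_in v0K v in
  mpolyC d (P (lshift d 0) i) +
  \sum_(j < d) P (rshift 1 j) i *: mpolyX R (mnm1 j).
exists lam => x.
pose X : 'rV[R]_(1 + d) := row_mx 1%:M x.
have lamE i : polyfun (lam (enum_val i)) x = (X *m P) 0 i.
  rewrite /lam /= enum_valK_in polyfunD polyfunC /= polyfun_sum.
  rewrite [RHS]mxE big_split_ord /= big_ord1 row_mxEl [1%:M _ _]mxE eqxx mul1r.
  by congr (_ + _); apply: eq_bigr => j _; rewrite polyfunZ polyfunX row_mxEr mulrC.
have XPM : X *m P *m M = X by rewrite mulmxKpV // submx_full.
have XPMj j : \sum_i (X *m P) 0 i * M i j = X 0 j.
  by rewrite -[in RHS]XPM [in RHS]mxE.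
split.
  rewrite big_enum_val; under eq_bigr do rewrite lamE.
  have := XPMj (lshift d 0); rewrite {2}/X row_mxEl mxE eqxx mulr1n => <-.
  by apply: eq_bigr => j _; rewrite ML mulr1.
rewrite big_enum_val; under eq_bigr do rewrite lamE.
apply/rowP => k; have := XPMj (rshift 1 k); rewrite {2}/X row_mxEr => <-.
by rewrite summxE; apply: eq_bigr => j _; rewrite MR [RHS]mxE.
Qed.

Lemma open_simplexE K (lam : V -> mpoly d R) x :
  affinely_independent pos K ->
  (\sum_(v in K) polyfun (lam v) x = 1 /\
   x = \sum_(v in K) polyfun (lam v) x *: pos v) ->
  open_simplex pos K x <-> forall v, v \in K -> 0 < polyfun (lam v) x.
Proof.
move=> indK [lam1 xlam]; split=> [[l [l0 l1 xl]] v vK|lam0]; last first.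
  by exists (fun v => polyfun (lam v) x).
rewrite -(@barycentric_unique K l (fun v => polyfun (lam v) x) indK _ _ v vK).
- exact: l0.
- by rewrite l1 lam1.
- by rewrite -xl -xlam.
Qed.

Lemma open_simplex_bounded S : exists M : R, open_simplex pos S `<=` box 0 M.
Proof.
exists (1 + \sum_v \sum_i `|pos v 0 i|) => x [l [l0 l1 ->]] i.
rewrite mxE sub0r normrN summxE; apply: (le_lt_trans (ler_norm_sum _ _ _)).
rewrite ltr_pwDl //; apply: (@le_trans _ _ (\sum_(v in S) `|pos v 0 i|)).
  apply: ler_sum => v vS; rewrite mxE normrM (ger0_norm (ltW (l0 v vS))).
  rewrite ler_piMl // -l1 (bigD1 v) //= lerDl sumr_ge0 // => w /andP[wS _].
  exact/ltW/l0.
rewrite big_mkcond /=; apply: ler_sum => v _; case: ifP => _.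
  by rewrite (bigD1 i) //= lerDl sumr_ge0.
by rewrite sumr_ge0.
Qed.

Lemma open_simplex_open K : #|K| = d.+1 -> affinely_independent pos K ->
  open (open_simplex pos K).
Proof.
move=> cK indK; have [lam lamP] := barycentric_coordinates cK indK.
rewrite openE => x /(open_simplexE indK (lamP x)) lam0.
have : nbhs x [set y | forall v, v \in K -> 0 < polyfun (lam v) y].
  apply: (@filter_forall _ _ (fun v y => v \in K -> 0 < polyfun (lam v) y) _
    (nbhs_filter x)) => v.
  have [vK|vK] := boolP (v \in K); last exact: nearW.
  have := @continuous_polyfun R d (lam v) x _ (lt_nbhsr (lam0 v vK)).
  by apply: (@filterS _ _ (nbhs_filter x)) => y.
by apply: (@filterS _ _ (nbhs_filter x)) => y /(open_simplexE indK (lamP y)).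
Qed.

Lemma measurable_open_simplex K : #|K| = d.+1 -> affinely_independent pos K ->
  measurable (open_simplex pos K).
Proof.
move=> cK indK; have [lam lamP] := barycentric_coordinates cK indK.
rewrite (_ : open_simplex pos K =
    \big[setI/setT]_(v in K) (polyfun (lam v) @^-1` `]0, +oo[)).
  apply: bigsetI_measurable => v _; rewrite -[X in measurable X]setTI.
  by apply: measurable_polyfun => //; exact: measurable_itv.
rewrite -big_enum -bigcap_seq; apply/seteqP; split=> x /=.
  move=> /(open_simplexE indK (lamP x)) lam0 v /=.
  by rewrite mem_enum in_itv /= andbT; exact: lam0.
move=> lam0; apply/(open_simplexE indK (lamP x)) => v vK.
by have := lam0 v; rewrite /= mem_enum in_itv /= andbT; exact.
Qed.

End simplices.

(** * Traces of piecewise polynomial fields *)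

Section traces.
Import -(notations) mpoly.
Context {R : realType} {d : nat} {V : finType} (pos : V -> 'rV[R]_d).
Implicit Types (S K : {set V}) (v w : V) (x y u : 'rV[R]_d).

(** Membership in the closure makes the filter [within D (nbhs x)] proper, so its limit is unique;
    along it [w] agrees with polynomials, which are continuous at [x]. *)
Lemma element_traceE K (w : 'rV[R]_d -> 'rV[R]_d) (p : 'I_d -> mpoly d R) x :
  closure (open_simplex pos K) x ->
  (forall i y, open_simplex pos K y -> w y 0 i = polyfun (p i) y) ->
  element_trace pos K w x = \row_i polyfun (p i) x.
Proof.
move=> Kx wp; set D := open_simplex pos K.
have PF : ProperFilter (within D (nbhs x)) by exact: within_nbhs_proper.
apply: (@cvg_lim _ (@norm_hausdorff _ 'rV[R]_d) _ _ PF).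
pose g y : 'rV[R]_d := \row_i polyfun (p i) y.
have cg : {for x, continuous g}.
  apply: continuous_rV => i.
  rewrite (_ : (fun s => g s 0 i) = polyfun (p i)); first exact: continuous_polyfun.
  by apply/funext => s; rewrite mxE.
move=> A /(cg A) gA; rewrite /= /within /=.
apply: (@filterS _ _ (nbhs_filter x)) gA => y gyA Dy.
have gw : g y = w y by apply/rowP => i; rewrite mxE wp.
by move: gyA; rewrite /= gw.
Qed.

End traces.

(** * Outward normals of neighbouring elements *)

Section normals.
Import -(notations) mpoly.
Context {R : realType} {d : nat} {V : finType} (pos : V -> 'rV[R]_d).
Implicit Types (S K : {set V}) (v w : V) (x y u n : 'rV[R]_d).

(** The definition speaks only of points of the open facet, to which a vertex need not belong. The
    midpoint of [x] and [pos w] does belong to it. *)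
Lemma facet_normal_orthogonal K v n x w : outward_unit_normal pos K v n ->
  open_simplex pos (K :\ v) x -> w \in K :\ v -> dot n (pos w - x) = 0.
Proof.
move=> [_ n0 _] Fx wF.
have /(n0 _ _ Fx) : open_simplex pos (K :\ v) (x + 2^-1 *: (pos w - x)).
  have [l [l0 l1 xl]] := Fx.
  exists (fun a => 2^-1 * l a + 2^-1 * (a == w)%:R); split.
  - move=> a aF; apply: ltr_wpDr; first by rewrite mulr_ge0 ?invr_ge0.
    by rewrite mulr_gt0 ?l0 // invr_gt0.
  - rewrite big_split /= -!mulr_sumr l1 (bigD1 w) //= eqxx big1 => [|a /andP[_]].
      by rewrite addr0 mulr1 [RHS]splitr mul1r.
    by move=> /negPf ->.
  - under [RHS]eq_bigr do rewrite scalerDl -!scalerA.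
    rewrite big_split /= -!scaler_sumr -xl (bigD1 w) //= eqxx scale1r.
    rewrite big1 => [|a /andP[_ /negPf ->]]; last by rewrite scale0r.
    rewrite addr0 scalerBr; set b := 2^-1 *: pos w; set a := 2^-1 *: x.
    have -> : x = a + a by rewrite -scalerDl -[2^-1]mul1r -splitr scale1r.
    by rewrite addrA (addrAC a a b) addrK.
rewrite addrAC subrr add0r dotZr => /eqP; rewrite mulf_eq0 invr_eq0.
by rewrite pnatr_eq0 /= => /eqP.
Qed.

(** As the weights sum to 1, [z - x] is the sum of the [l w *: (pos w - x)], and only the term at
    [v] is not orthogonal to [n]. Weights may be negative, so [z] need not lie in [K]. *)
Lemma facet_normal_barycentric K v n x (l : V -> R) z :
  outward_unit_normal pos K v n -> v \in K ->
  open_simplex pos (K :\ v) x -> \sum_(w in K) l w = 1 ->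
  z = \sum_(w in K) l w *: pos w -> dot n (z - x) = l v * dot n (pos v - x).
Proof.
move=> nP vK Fx l1 ->.
rewrite -[X in _ - X]scale1r -l1 scaler_suml -sumrB.
under eq_bigr do rewrite -scalerBr.
rewrite dot_sumr (bigD1 v) //= big1 ?addr0 ?dotZr // => w /andP[wK wv].
rewrite dotZr (facet_normal_orthogonal nP Fx) ?mulr0 //.
by rewrite !inE wv.
Qed.

Lemma facet_normal_apex K v n x : outward_unit_normal pos K v n -> v \in K ->
  open_simplex pos (K :\ v) x -> dot n (pos v - x) < 0.
Proof.
move=> nP vK Fx; have [|z Kz] := @open_simplex_nonempty _ _ _ pos K.
  by apply/card_gt0P; exists v.
have [_ _ /(_ _ _ Fx Kz)] := nP.
have [l [l0 l1 zl]] := Kz.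
by rewrite (facet_normal_barycentric nP vK Fx l1 zl) pmulr_rlt0 // l0.
Qed.

(** Measured from [x], both normal components are multiples of the barycentric coordinate [lam v] of
    [K], so [n' = c *: n]. Unit length leaves [c = 1] or [c = -1], and disjointness of the open
    elements excludes [c = 1]. *)
Lemma opposite_normals (Omega : set 'rV[R]_d) (T : {set {set V}}) K K' v v' n n' x :
  triangulation pos Omega T -> K \in T -> K' \in T -> K != K' ->
  v \in K -> v' \in K' -> K :\ v = K' :\ v' ->
  outward_unit_normal pos K v n -> outward_unit_normal pos K' v' n' ->
  open_simplex pos (K :\ v) x -> n' = - n.
Proof.
move=> hT KT K'T KK' vK v'K' FF' nP n'P Fx.
have indK := mesh_nondegenerate hT KT.
have [lam lamP] := barycentric_coordinates (mesh_card hT KT) indK.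
have h0 := facet_normal_apex nP vK Fx.
have F'x := Fx; rewrite FF' in F'x.
have nz z : dot n (z - x) = polyfun (lam v) z * dot n (pos v - x).
  exact: (facet_normal_barycentric nP vK Fx (lamP z).1 (lamP z).2).
(* [n'] is a normal of [K'], not of [K], so the computation is redone: it uses only orthogonality to
   the vertices of the shared facet. *)
have n'z z : dot n' (z - x) = polyfun (lam v) z * dot n' (pos v - x).
  have [l1 zl] := lamP z.
  rewrite {1}zl -[X in _ - X]scale1r -l1 scaler_suml -sumrB.
  under eq_bigr do rewrite -scalerBr.
  rewrite dot_sumr (bigD1 v) //= big1 ?addr0 ?dotZr // => w /andP[wK wv].
  rewrite dotZr (facet_normal_orthogonal n'P F'x) ?mulr0 //.
  by rewrite -FF' !inE wv.
pose c := dot n' (pos v - x) / dot n (pos v - x).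
have n'c : n' = c *: n.
  apply/eqP; rewrite -subr_eq0; apply/eqP/dot_eq0.
  set u := n' - c *: n; have xu : u = (x + u) - x by rewrite addrC addKr.
  rewrite {2}xu /u dotDl dotNl dotZl nz n'z -/u /c.
  by rewrite mulrCA -mulrA mulVf ?lt_eqF // mulr1 mulrC subrr.
have : c ^+ 2 = 1.
  have [nn _ _] := nP; have [+ _ _] := n'P.
  by rewrite n'c dotZl dotZr nn mulr1.
move=> /eqP; rewrite sqrf_eq1 => /orP[/eqP c1|/eqP cN1]; last first.
  by rewrite n'c cN1 scaleN1r.
(* Equal normals would put both elements on the same side of the facet. *)
exfalso; move: n'c; rewrite c1 scale1r => n'n.
have [|u K'u] := @open_simplex_nonempty _ _ _ pos K'.
  by apply/card_gt0P; exists v'.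
have lamx w : w \in K :\ v -> 0 < polyfun (lam w) x.
  move=> wF; have FK : K :\ v \subset K by exact: finset.subsetDl.
  have wK : w \in K by have := fintype.subsetP FK w wF.
  have [l [l0 l1 xl]] := Fx; have [lam1 xlam] := lamP x.
  rewrite (@barycentric_unique _ _ _ _ K (fun w => polyfun (lam w) x)
    (fun w => if w \in K :\ v then l w else 0) indK _ _ w wK).
  - by rewrite wF l0.
  - by rewrite sum_restrict // l1 lam1.
  - by rewrite sum_restrictZ // -xl -xlam.
have /(segment_nbhs u)[e e01 lamy] :
    nbhs x [set y | forall w, w \in K :\ v -> 0 < polyfun (lam w) y].
  apply: (@filter_forall _ _
    (fun w y => w \in K :\ v -> 0 < polyfun (lam w) y) _ (nbhs_filter x)) => w.
  have [wF|wF] := boolP (w \in K :\ v); last exact: nearW.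
  have := @continuous_polyfun R d (lam w) x _ (lt_nbhsr (lamx w wF)).
  by apply: (@filterS _ _ (nbhs_filter x)) => y.
set y := x + e *: (u - x) in lamy.
have K'y : open_simplex pos K' y.
  apply: open_simplex_segment => //.
  by apply: closed_simplex_sub (open_simplex_closed F'x); exact: finset.subsetDl.
(* The coordinates of [y] in [K] are positive: at the facet vertices by continuity from [x], and at
   [v] because [n = n'] is outward for [K'], so that [dot n (y - x)] is negative like
   [dot n (pos v - x)]. *)
have Ky : open_simplex pos K y.
  apply/(open_simplexE indK (lamP y)) => w wK.
  have [->|wv] := eqVneq w v; last by apply: lamy; rewrite !inE wv.
  have : dot n (y - x) < 0.
    rewrite /y addrAC subrr add0r dotZr pmulr_rlt0; last by case/andP: e01.
    by rewrite -n'n; have [_ _] := n'P; exact.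
  by rewrite nz nmulr_llt0.
by move/eqP: KK'; apply; exact: (open_simplex_inj hT KT K'T) Ky K'y.
Qed.

End normals.

(** * Positivity of the Gram determinant *)

Section gram.
Context {R : realType}.

Lemma quad_gram m n (E : 'M[R]_(m, n)) (u : 'rV[R]_m) :
  (u *m (E *m E^T) *m u^T) 0 0 = dot (u *m E) (u *m E).
Proof.
rewrite mulmxA -mulmxA -trmx_mul mxE; apply: eq_bigr => k _.
by rewrite [X in _ * X]mxE.
Qed.

(* The characteristic polynomial of - G is monic without nonnegative root, and
   its value at 0 is the determinant of G. *)
Lemma gram_det_gt0 m n (E : 'M[R]_(m, n)) : row_free E -> 0 < \det (E *m E^T).
Proof.
move=> freeE; set G := E *m E^T.
have noroot s : 0 <= s -> ~~ root (char_poly (- G)) s.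
  move=> s0; rewrite -eigenvalue_root_char; apply/negP => /eigenvalueP[u uG u0].
  (* The two sides have opposite signs, so both vanish; then [u *m E = 0], and [u = 0] by
     freeness. *)
  have : - dot (u *m E) (u *m E) = s * dot u u.
    rewrite -quad_gram -/G; have := congr1 (fun x => (x *m u^T) 0 0) uG.
    rewrite mulmxN mulNmx mxE => ->; rewrite -scalemxAl mxE mxE; congr (_ * _).
    by apply: eq_bigr => k _; rewrite [X in _ * X]mxE.
  move=> Es; have : dot (u *m E) (u *m E) = 0.
    by apply/eqP; rewrite eq_le dot_ge0 andbT -oppr_ge0 Es mulr_ge0 // dot_ge0.
  move=> /dot_eq0/eqP; rewrite mulmx_free_eq0 // => /eqP u0'.
  by rewrite u0' eqxx in u0.
have detG : \det G = (char_poly (- G)).[0].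
  rewrite horner_coef0 char_poly_det -(scaleN1r G) detZ mulrA -exprMn.
  by rewrite mulrNN mulr1 expr1n mul1r.
(* With a nonpositive value at 0 and nonnegative values far out, the intermediate value theorem
   would give a root; [Num.max 0 M] keeps the interval to the right of 0. *)
rewrite ltNge; apply/negP => det0.
have [M HM] : exists M, forall x, M <= x -> 0 <= (char_poly (- G)).[x].
  have lc : lead_coef (char_poly (- G)) = 1 by apply/eqP/char_poly_monic.
  have [|M HM] := @polyrcf.poly_pinfty_gt_lc _ (char_poly (- G)).
    by rewrite lc.
  by exists M => x /HM; apply: le_trans; rewrite lc.
have [||s /andP[s0 _] rs] := @poly_ivt R (char_poly (- G)) 0 (Num.max 0 M).
- by rewrite le_max lexx.
- by rewrite -detG det0 HM // le_max lexx orbT.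
by move: (noroot s s0); rewrite rs.
Qed.

End gram.

(** * The affine parametrization of a facet *)

Section facet_parametrization.
Import -(notations) mpoly.
Context {R : realType} {m : nat} {V : finType} (pos : V -> 'rV[R]_m.+1).
Variable F : {set V}.
Hypothesis cF : #|F| = m.+1.
Let p (i : nat) : 'rV[R]_m.+1 := (facet_points pos F)`_i.

(** Translates weights indexed by vertices into weights indexed by the enumeration behind
    [facet_points], with the base point split off. *)
Lemma facet_point_sum (l : V -> R) (g : nat -> R) v0 :
  (forall i, (i < m.+1)%N -> l (nth v0 (enum F) i) = g i) ->
  \sum_(v in F) l v = g 0%N + \sum_(j < m) g j.+1 /\
  \sum_(v in F) l v *: pos v = g 0%N *: p 0%N + \sum_(j < m) g j.+1 *: p j.+1.
Proof.
have sF : size (enum F) = m.+1 by rewrite -cardE.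
move=> lg; split.
  rewrite -big_enum (big_nth v0) sF big_mkord big_ord_recl lg //.
  by congr (_ + _); apply: eq_bigr => j _; rewrite lg // ltnS.
rewrite -big_enum (big_nth v0) sF big_mkord big_ord_recl lg //.
have pE i : (i < m.+1)%N -> p i = pos (nth v0 (enum F) i).
  by move=> im; rewrite /p /facet_points (nth_map v0) ?sF.
rewrite pE //; congr (_ + _); apply: eq_bigr => j _.
have jm : (j.+1 < m.+1)%N by rewrite ltnS.
by rewrite (pE _ jm) -(lg _ jm).
Qed.

Lemma facet_paramE t : facet_param pos F t =
  (1 - \sum_j t 0 j) *: p 0%N + \sum_(j < m) t 0 j *: p j.+1.
Proof.
rewrite /facet_param -/(p 0%N).
have -> : t *m facet_edges pos F = \sum_(j < m) t 0 j *: (p j.+1 - p 0%N).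
  apply/rowP => i; rewrite mxE summxE; apply: eq_bigr => j _.
  by rewrite mxE [in RHS]mxE.
under eq_bigr do rewrite scalerBr.
by rewrite sumrB -scaler_suml scalerBl scale1r addrA addrAC.
Qed.

Let facet_vertex : exists v0, v0 \in F.
Proof. by apply/card_gt0P; rewrite cF. Qed.

Lemma facet_param_open t :
  reference_simplex t -> open_simplex pos F (facet_param pos F t).
Proof.
move=> [t0 t1]; have [v0 v0F] := facet_vertex.
(* For [j < m] the filtered sum has the single term [t 0 j]; this reads a coordinate at a plain
   natural number. *)
pose g (i : nat) : R := if i is j.+1 then \sum_(k < m | k == j :> nat) t 0 k
  else 1 - \sum_j t 0 j.
have gS (j : 'I_m) : g j.+1 = t 0 j.
  by rewrite /g (eq_bigl (pred1 j)) ?big_pred1_eq.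
have sF : size (enum F) = m.+1 by rewrite -cardE.
have [] := @facet_point_sum (fun v => g (index v (enum F))) g v0.
  by move=> i im; rewrite index_uniq ?enum_uniq ?sF.
rewrite (eq_bigr _ (fun j _ => gS j)) => l1.
rewrite (eq_bigr (fun j : 'I_m => t 0 j *: p j.+1)) => [lp|j _]; last by rewrite gS.
exists (fun v => g (index v (enum F))); split.
- move=> v vF; have : (index v (enum F) < m.+1)%N.
    by rewrite -sF index_mem mem_enum.
  case: (index _ _) => [_|j jm]; first by rewrite /g subr_gt0.
  by have -> := gS (Ordinal (jm : (j < m)%N)); exact: t0.
- by rewrite l1 /g subrK.
- by rewrite lp facet_paramE.
Qed.

Lemma facet_param_surj x : open_simplex pos F x ->
  exists2 t, reference_simplex t & facet_param pos F t = x.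
Proof.
move=> [l [l0 l1 xl]]; have [v0 v0F] := facet_vertex.
have sF : size (enum F) = m.+1 by rewrite -cardE.
have gF i : (i < m.+1)%N -> nth v0 (enum F) i \in F.
  by move=> im; rewrite -mem_enum mem_nth ?sF.
have [] := @facet_point_sum l (fun i => l (nth v0 (enum F) i)) v0 => //.
rewrite l1 -xl => l1' xl'.
exists (\row_j l (nth v0 (enum F) j.+1)).
  split=> [i|]; first by rewrite mxE l0 // gF // ltnS.
  under eq_bigr do rewrite mxE.
  by rewrite l1' ltrDr l0 ?gF.
rewrite facet_paramE xl'; congr (_ *: _ + _).
  by rewrite l1'; under [X in _ - X]eq_bigr do rewrite mxE; rewrite addrK.
by apply: eq_bigr => j _; rewrite mxE.
Qed.

(** A vanishing combination of edges is one of vertices, with the opposite of the sum of [t] as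
    weight at the base point. The weights have total 0, so affine independence kills them. *)
Lemma facet_edges_free : affinely_independent pos F ->
  row_free (facet_edges pos F).
Proof.
move=> indF; apply: inj_row_free => t tE; have [v0 v0F] := facet_vertex.
pose g (i : nat) : R := if i is j.+1 then \sum_(k < m | k == j :> nat) t 0 k
  else - \sum_j t 0 j.
have gS (j : 'I_m) : g j.+1 = t 0 j.
  by rewrite /g (eq_bigl (pred1 j)) ?big_pred1_eq.
have sF : size (enum F) = m.+1 by rewrite -cardE.
have [] := @facet_point_sum (fun v => g (index v (enum F))) g v0.
  by move=> i im; rewrite index_uniq ?enum_uniq ?sF.
rewrite (eq_bigr _ (fun j _ => gS j)) {2}/g addNr => l1.
rewrite (eq_bigr (fun j : 'I_m => t 0 j *: p j.+1)) => [lp|j _]; last by rewrite gS.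
apply/rowP => j; rewrite mxE -gS.
have jF : nth v0 (enum F) j.+1 \in F.
  by rewrite -mem_enum mem_nth ?sF ?ltnS.
have := indF _ l1 _ _ jF; rewrite index_uniq ?enum_uniq ?sF ?ltnS //; apply.
rewrite lp; have := facet_paramE t; rewrite /facet_param tE addr0 -/(p 0%N).
by rewrite scalerBl scale1r -addrA -{1}[p 0%N]addr0 => /addrI; rewrite -scaleNr.
Qed.

Lemma facet_param_coord i :
  exists q : mpoly m R, (fun t => facet_param pos F t 0 i) = polyfun q.
Proof.
exists (mpolyC m (p 0%N 0 i) +
  \sum_(j < m) facet_edges pos F j i *: mpolyX R (mnm1 j)).
apply/funext => t; rewrite /facet_param mxE [X in _ + X]mxE.
rewrite polyfunD polyfunC /= polyfun_sum.
by congr (_ + _); apply: eq_bigr => j _; rewrite polyfunZ polyfunX mulrC.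
Qed.

Lemma continuous_facet_param : continuous (facet_param pos F).
Proof.
move=> t; apply: continuous_rV => i.
by have [q ->] := facet_param_coord i; exact: continuous_polyfun.
Qed.

Lemma measurable_facet_param : measurable_fun setT (facet_param pos F).
Proof.
apply: measurable_fun_coordP => i.
by have [q ->] := facet_param_coord i; exact: measurable_polyfun.
Qed.

End facet_parametrization.

(** * The parameter domain of the facets *)

Section reference_simplex.
Import -(notations) mpoly.
Context {R : realType} {m : nat}.

Lemma reference_simplex_bounded : @reference_simplex R m `<=` box 0 1.
Proof.
move=> t [t0 t1] i; rewrite mxE sub0r normrN gtr0_norm //.
apply: le_lt_trans t1; rewrite (bigD1 i) //= lerDl sumr_ge0 // => j _.
exact/ltW.
Qed.

(** The remaining barycentric coordinate: the bound on the sum becomes positivity of a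
    polynomial. *)
Let gap : mpoly m R := mpolyC m 1 - \sum_(j < m) mpolyX R (mnm1 j).

Let gapE t : polyfun gap t = 1 - \sum_j t 0 j.
Proof.
rewrite /gap -scaleN1r polyfunD polyfunC polyfunZ mulN1r polyfun_sum /=.
by congr (_ - _); apply: eq_bigr => j _; rewrite polyfunX.
Qed.

Lemma reference_simplex_open : open (@reference_simplex R m).
Proof.
rewrite openE => t [t0 t1].
have g0 : 0 < polyfun gap t by rewrite gapE subr_gt0.
have := @continuous_polyfun R m gap t _ (lt_nbhsr g0).
have : nbhs t [set s : 'rV[R]_m | forall i, 0 < s 0 i].
  apply: (@filter_forall _ _ (fun i (s : 'rV[R]_m) => 0 < s 0 i) _
    (nbhs_filter t)) => i.
  exact: (@coord_continuous _ _ _ 0 i t _ (lt_nbhsr (t0 i))).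
move=> /(@filterI _ _ (nbhs_filter t)) /[apply].
by apply: (@filterS _ _ (nbhs_filter t)) => s []; rewrite /= gapE subr_gt0.
Qed.

Lemma measurable_reference_simplex : measurable (@reference_simplex R m).
Proof.
rewrite (_ : reference_simplex =
    (\big[setI/setT]_i ((fun x : 'rV[R]_m => x 0 i) @^-1` `]0, +oo[))
    `&` polyfun gap @^-1` `]0, +oo[).
  apply: measurableI.
    apply: bigsetI_measurable => i _; rewrite -[X in measurable X]setTI.
    by apply: measurable_coord => //; exact: measurable_itv.
  rewrite -[X in measurable X]setTI.
  by apply: measurable_polyfun => //; exact: measurable_itv.
rewrite -bigcap_seq; apply/seteqP; split=> t /= [t0 t1]; split.
- by move=> i _; rewrite /= in_itv /= andbT; exact: t0.
- by rewrite in_itv /= gapE subr_gt0 t1.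
- by move=> i; have := t0 i; rewrite /= mem_index_enum in_itv /= andbT; exact.
- by move: t1; rewrite in_itv /= gapE subr_gt0 andbT.
Qed.

End reference_simplex.

(** * Integrals of products of polynomials *)

Section moments.
Import -(notations) mpoly.
Context {R : realType}.

(** The map [phi] covers both uses, the identity on elements and [facet_param] on facets. *)
Lemma integrable_polyfun_comp n d (D : set 'rV[R]_n) (M M' : R)
    (phi : 'rV[R]_n -> 'rV[R]_d) (p q : mpoly d R) :
  measurable D -> D `<=` box 0 M -> measurable_fun setT phi ->
  (forall t, D t -> box 0 M' (phi t)) ->
  (lebesgue_rV n).-integrable D
    (EFin \o (fun t => polyfun p (phi t) * polyfun q (phi t))).
Proof.
move=> mD DM mphi phiM'.
have [C HC] := polyfun_bounded M' (p * q).
apply: (@integrable_bounded R n D _ M C mD DM) => [|t Dt].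
  rewrite (_ : (fun s => _) = polyfun (p * q) \o phi); last first.
    by apply/funext => s; rewrite /= polyfunM.
  apply: measurable_funTS.
  by apply: (measurableT_comp _ mphi); exact: measurable_polyfun.
have := HC (phi t); rewrite polyfunM; apply => i.
by have := phiM' t Dt i; rewrite mxE sub0r normrN => /ltW.
Qed.

Lemma polyfun_sqr_eq0 n d (D : set 'rV[R]_n) (M M' : R)
    (phi : 'rV[R]_n -> 'rV[R]_d) (p : mpoly d R) :
  open D -> measurable D -> D `<=` box 0 M ->
  continuous phi -> measurable_fun setT phi ->
  (forall t, D t -> box 0 M' (phi t)) ->
  \int[lebesgue_rV n]_(t in D) (polyfun p (phi t) * polyfun p (phi t)) = 0 ->
  forall t, D t -> polyfun p (phi t) = 0.
Proof.
move=> oD mD DM cphi mphi phiM' int0 t Dt.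
have [C HC] := polyfun_bounded M' (p * p).
pose f t := polyfun p (phi t) * polyfun p (phi t).
have fE : f = polyfun (p * p) \o phi by apply/funext => s; rewrite /f /= polyfunM.
have mf : measurable_fun setT f.
  by rewrite fE; apply: (measurableT_comp _ mphi); exact: measurable_polyfun.
have : f t = 0.
  apply: (@Rintegral_ge0_eq0 R n D f M C oD mD DM (measurable_funTS mf)) => //.
    move=> s Ds; rewrite {1}/f -expr2 sqr_ge0 /=; apply: le_trans (ler_norm _) _.
    have := HC (phi s); rewrite polyfunM; apply => i.
    by have := phiM' s Ds i; rewrite mxE sub0r normrN => /ltW.
  move=> s _; rewrite fE; apply: continuous_comp; first exact: cphi.
  exact: continuous_polyfun.
by move=> /eqP; rewrite /f mulf_eq0 orbb => /eqP.
Qed.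

End moments.

(** * Testing on elements *)

Section elements.
Import -(notations) mpoly.
Context {R : realType} {d : nat} {V : finType} (pos : V -> 'rV[R]_d).
Context (Omega : set 'rV[R]_d) (T : {set {set V}}) (k : nat).
Hypothesis hT : triangulation pos Omega T.

Lemma element_open K : K \in T -> open (open_simplex pos K).
Proof.
move=> KT; apply: open_simplex_open; first exact: mesh_card hT _ KT.
exact: mesh_nondegenerate hT _ KT.
Qed.

Lemma element_measurable K : K \in T -> measurable (open_simplex pos K).
Proof.
move=> KT; apply: measurable_open_simplex; first exact: mesh_card hT _ KT.
exact: mesh_nondegenerate hT _ KT.
Qed.

Lemma element_disjoint K K' x : K \in T -> K' \in T ->
  open_simplex pos K x -> open_simplex pos K' x -> K = K'.
Proof. by move=> KT K'T; apply: (open_simplex_inj hT KT K'T). Qed.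

Lemma Q_space_polyfun K (p : mpoly d R) : K \in T -> (msize p <= k.-1.+1)%N ->
  Q_space pos Omega T k (polyfun p \_ (open_simplex pos K)).
Proof.
move=> KT pk; set D := open_simplex pos K.
have mD : measurable D by exact: element_measurable.
split; [split|move=> K' K'T].
- apply: measurable_funTS; apply/(measurable_restrictT _ mD).
  by apply: measurable_funTS; exact: measurable_polyfun.
- have [M DM] := open_simplex_bounded pos K.
  (* Since [K] lies in [Omega], the integral over [Omega] of the square of the extension is the
     integral of the square of [p] over [K]. *)
  rewrite integral_mkcond
    [X in (\int[_]_x X x)%E](_ : _ =
      (fun x => (polyfun p x * polyfun p x)%:E) \_ D); last first.
    apply/funext => x; rewrite !patchE.
    case: ifPn => [_|xO]; case: ifPn => [xD|_] //.
      by rewrite expr0n.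
    by move: xO; rewrite notin_setE; case; apply: (mesh_sub hT KT); rewrite -/D -inE.
  rewrite -integral_mkcond.
  have ip := @integrable_polyfun_comp R d d D M M id p p mD DM
    (@measurable_id _ _ _) DM.
  by have /fineK <- := integrable_fin_num mD ip; rewrite ltry.
- have [->|KK'] := eqVneq K' K.
    by exists p => // x Dx; rewrite patchE mem_set.
  exists 0; first by rewrite msize0.
  move=> x K'x; rewrite meval0 patchE memNset // => Kx.
  by move/eqP: KK'; apply; exact: element_disjoint K'x Kx.
Qed.

(** Derivatives at [x] depend only on nearby values, and the open element is a neighbourhood of [x]
    where [B] is polynomial. *)
Lemma divergence_polyfun K (B : 'rV[R]_d -> 'rV[R]_d) (p : 'I_d -> mpoly d R) x :
  K \in T -> (forall i y, open_simplex pos K y -> B y 0 i = polyfun (p i) y) ->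
  open_simplex pos K x ->
  divergence B x = polyfun (\sum_i mderiv i (p i)) x.
Proof.
move=> KT Bp Kx; rewrite polyfun_sum; apply: eq_bigr => i _.
have [_ <-] := is_derive_polyfun (p i) i x.
apply: near_eq_derive.
have : nbhs x (open_simplex pos K).
  by apply: open_nbhs_nbhs; split => //; exact: element_open.
by apply: (@filterS _ _ (nbhs_filter x)) => y Ky; rewrite Bp.
Qed.

Lemma W_space_polyfun (B : 'rV[R]_d -> 'rV[R]_d) K :
  W_space pos Omega T k B -> K \in T ->
  exists p : 'I_d -> mpoly d R, forall i, (msize (p i) <= k.+1)%N /\
    forall y, open_simplex pos K y -> B y 0 i = polyfun (p i) y.
Proof.
move=> BW KT.
have /choice[p pP] : forall i, exists p : mpoly d R, (msize p <= k.+1)%N /\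
    forall y, open_simplex pos K y -> B y 0 i = polyfun p y.
  by move=> i; have [_ /(_ _ KT)[p pk Bp]] := BW i; exists p.
by exists p.
Qed.

Lemma divergence_eq0 (B : 'rV[R]_d -> 'rV[R]_d) : (1 <= k)%N ->
  W_space pos Omega T k B ->
  (forall q : 'rV[R]_d -> R, Q_space pos Omega T k q ->
    \sum_(K in T)
      \int[lebesgue_rV d]_(x in open_simplex pos K) (q x * divergence B x) = 0) ->
  forall K x, K \in T -> open_simplex pos K x -> divergence B x = 0.
Proof.
move=> k1 BW hdiv K x KT Kx; have [p Hp] := W_space_polyfun BW KT.
have Bp i y : open_simplex pos K y -> B y 0 i = polyfun (p i) y.
  by move=> Ky; apply: (Hp i).2.
pose P := \sum_i mderiv i (p i).
have divP y : open_simplex pos K y -> divergence B y = polyfun P y.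
  exact: divergence_polyfun.
have Pk : (msize P <= k.-1.+1)%N.
  (* By [1 <= k], [k.-1.+1] is [k], the size bound left after one derivative. *)
  rewrite prednK //; apply: (leq_trans (msize_sum _ _ _)).
  by apply/bigmax_leqP => i _; apply: msize_mderiv; exact: (Hp i).1.
rewrite divP //; have [M KM] := open_simplex_bounded pos K.
apply: (@polyfun_sqr_eq0 R d d (open_simplex pos K) M M id P) => //.
- exact: element_open.
- exact: element_measurable.
  by move=> y; exact: cvg_id.
have := hdiv _ (Q_space_polyfun KT Pk).
rewrite (bigD1 K) //= [X in _ + X]big1 => [|K' /andP[K'T K'K]]; last first.
  rewrite (@eq_Rintegral _ _ _ _ _ (fun=> 0)) ?/Rintegral ?integral0 // => y.
  rewrite inE => K'y; rewrite patchE memNset ?mul0r // => Ky.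
  by move/eqP: K'K; apply; exact: element_disjoint K'y Ky.
rewrite addr0 => <-; apply: eq_Rintegral => y; rewrite inE => Ky.
by rewrite patchE mem_set // divP.
Qed.

End elements.

(** * Testing on facets *)

Section facets.
Import -(notations) mpoly.
Context {R : realType} {m : nat} {V : finType} (pos : V -> 'rV[R]_m.+1).
Context (Omega : set 'rV[R]_m.+1) (T : {set {set V}}) (k : nat).
Hypothesis hT : triangulation pos Omega T.

Lemma facetP (F : {set V}) :
  F \in facets T -> exists K v, [/\ K \in T, v \in K & F = K :\ v].
Proof.
rewrite inE => /existsP[K /andP[KT /existsP[v /andP[vK /eqP FE]]]].
by exists K, v.
Qed.

Lemma facets_mem K v : K \in T -> v \in K -> K :\ v \in facets T.
Proof.
move=> KT vK; rewrite inE; apply/existsP; exists K; rewrite KT /=.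
by apply/existsP; exists v; rewrite vK /=.
Qed.

Lemma facet_card F : F \in facets T -> #|F| = m.+1.
Proof.
move=> /facetP[K [v [KT vK ->]]].
by have := mesh_card hT KT; rewrite (cardsD1 v) vK => -[].
Qed.

Lemma facet_independent F : F \in facets T -> affinely_independent pos F.
Proof.
move=> /facetP[K [v [KT vK ->]]].
by apply: affinely_independent_sub (mesh_nondegenerate hT KT); exact: finset.subsetDl.
Qed.

Lemma facet_disjoint F F' x : F \in facets T -> F' \in facets T ->
  open_simplex pos F x -> open_simplex pos F' x -> F = F'.
Proof.
move=> /facetP[K [v [KT vK ->]]] /facetP[K' [v' [K'T v'K' ->]]].
by apply: (open_simplex_inj hT KT K'T); exact: finset.subsetDl.
Qed.

Lemma integrable_facet F (p q : mpoly m.+1 R) : F \in facets T ->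
  (lebesgue_rV m).-integrable reference_simplex (EFin \o (fun t =>
    polyfun p (facet_param pos F t) * polyfun q (facet_param pos F t))).
Proof.
move=> FT; have [M FM] := open_simplex_bounded pos F.
apply: (@integrable_polyfun_comp R m m.+1 _ 1 M).
- exact: measurable_reference_simplex.
- exact: reference_simplex_bounded.
- exact: measurable_facet_param.
- by move=> t /(facet_param_open pos (facet_card FT)); exact: FM.
Qed.

(** The area factor is positive because the edges are free, so the integral itself vanishes, and
    every point of the open facet has a parameter. *)
Lemma facet_polyfun_eq0 F (p : mpoly m.+1 R) : F \in facets T ->
  Num.sqrt (\det (facet_edges pos F *m (facet_edges pos F)^T)) *
    \int[lebesgue_rV m]_(t in reference_simplex)
      (polyfun p (facet_param pos F t) * polyfun p (facet_param pos F t)) = 0 ->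
  forall x, open_simplex pos F x -> polyfun p x = 0.
Proof.
move=> FT /eqP; rewrite mulf_eq0 gt_eqF /=; last first.
  rewrite sqrtr_gt0; apply: gram_det_gt0.
  exact: facet_edges_free (facet_card FT) (facet_independent FT).
move=> /eqP int0 x /(facet_param_surj (facet_card FT))[t t01 <-].
have [M FM] := open_simplex_bounded pos F.
apply: (@polyfun_sqr_eq0 R m m.+1 reference_simplex 1 M) int0 t t01.
- exact: reference_simplex_open.
- exact: measurable_reference_simplex.
- exact: reference_simplex_bounded.
- exact: continuous_facet_param.
- exact: measurable_facet_param.
- by move=> t /(facet_param_open pos (facet_card FT)); exact: FM.
Qed.

Lemma Qhat_space_polyfun F (p : mpoly m.+1 R) :
  F \in facets T -> (msize p <= k.+1)%N ->
  Qhat_space pos T k (polyfun p \_ (open_simplex pos F)).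
Proof.
move=> FT pk F' F'T.
(* On each facet the extension is a single polynomial, [p] or 0, from which both membership
   conditions follow. *)
have [q qk qE] : exists2 q : mpoly m.+1 R, (msize q <= k.+1)%N &
    forall x, open_simplex pos F' x ->
      (polyfun p \_ (open_simplex pos F)) x = polyfun q x.
  have [->|FF'] := eqVneq F' F.
    by exists p => // x Fx; rewrite patchE mem_set.
  exists 0; first by rewrite msize0.
  move=> x F'x; rewrite /polyfun meval0 patchE memNset // => Fx.
  by move/eqP: FF'; apply; exact: facet_disjoint F'x Fx.
split; last by exists q.
have qE' t : reference_simplex t ->
    (polyfun p \_ (open_simplex pos F) \o facet_param pos F') t =
    polyfun q (facet_param pos F' t).
  by move=> t01; rewrite /= qE //; exact: facet_param_open (facet_card F'T) _ t01.
split.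
  apply: (eq_measurable_fun (polyfun q \o facet_param pos F')).
    by move=> t; rewrite inE => /qE' ->.
  apply: measurable_funTS; apply: (measurableT_comp _ (measurable_facet_param _ _)).
  exact: measurable_polyfun.
rewrite (eq_integral (fun t => (polyfun q (facet_param pos F' t) *
    polyfun q (facet_param pos F' t))%:E)) => [|t]; last first.
  by rewrite inE => /qE' ->; rewrite expr2.
have /fineK <- := integrable_fin_num (@measurable_reference_simplex R m)
  (integrable_facet q q F'T).
by rewrite ltry.
Qed.

Variables (B Bhat : 'rV[R]_m.+1 -> 'rV[R]_m.+1) (n : {set V} -> V -> 'rV[R]_m.+1).
Hypotheses (BW : W_space pos Omega T k B) (BhatW : What_space pos T k Bhat).

(** The normal is constant on the facet, so taking normal components keeps the degree at most [k],
    as a test function requires. *)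
Lemma normal_trace_polyfun K v : K \in T -> v \in K ->
  exists2 g : mpoly m.+1 R, (msize g <= k.+1)%N &
    forall x, open_simplex pos (K :\ v) x ->
      dot (element_trace pos K B x - Bhat x) (n K v) = polyfun g x.
Proof.
move=> KT vK; have [p pP] := W_space_polyfun BW KT.
have /choice[q qP] : forall i, exists q : mpoly m.+1 R, (msize q <= k.+1)%N /\
    forall x, open_simplex pos (K :\ v) x -> Bhat x 0 i = polyfun q x.
  move=> i; have [_ [q qk qE]] := BhatW i (facets_mem KT vK).
  by exists q.
exists (\sum_i n K v 0 i *: (p i - q i)).
  apply: (leq_trans (msize_sum _ _ _)); apply/bigmax_leqP => i _.
  apply: (leq_trans (msizeZ_le _ _)); apply: (leq_trans (msizeD_le _ _)).
  by rewrite msizeN geq_max (pP i).1 (qP i).1.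
move=> x Fx; have K0 : (0 < #|K|)%N by apply/card_gt0P; exists v.
have Kx := open_simplex_closure (finset.subsetDl _ _) K0 Fx.
rewrite (element_traceE Kx (fun i => (pP i).2)) polyfun_sum /dot.
apply: eq_bigr => i _.
rewrite polyfunZ -(scaleN1r (q i)) polyfunD polyfunZ mulN1r !mxE mulrC.
by rewrite (qP i).2.
Qed.

Hypothesis hjump : forall qhat : 'rV[R]_m.+1 -> R, Qhat_space pos T k qhat ->
  \sum_(K in T) \sum_(v in K)
    facet_integral pos (K :\ v) (fun x =>
      dot (element_trace pos K B x - Bhat x) (n K v) * qhat x) = 0.

(** For [w != v] the facet [K :\ w] omits [w] while [F] contains it, so the two are disjoint and the
    test function vanishes there. *)
Lemma facet_integral_restrict F K v (g p : mpoly m.+1 R) :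
  K \in T -> v \in K -> F = K :\ v ->
  (forall x, open_simplex pos F x ->
    dot (element_trace pos K B x - Bhat x) (n K v) = polyfun g x) ->
  \sum_(w in K) facet_integral pos (K :\ w) (fun x =>
      dot (element_trace pos K B x - Bhat x) (n K w) *
      (polyfun p \_ (open_simplex pos F)) x) =
  Num.sqrt (\det (facet_edges pos F *m (facet_edges pos F)^T)) *
    \int[lebesgue_rV m]_(t in reference_simplex)
      (polyfun g (facet_param pos F t) * polyfun p (facet_param pos F t)).
Proof.
move=> KT vK FE gE; have FT : F \in facets T by rewrite FE; exact: facets_mem.
rewrite (bigD1 v) //= big1 ?addr0 => [|w /andP[wK wv]].
  rewrite -FE /facet_integral; congr (_ * _); apply: eq_Rintegral => t.
  rewrite inE => /(facet_param_open pos (facet_card FT)) Ft.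
  by rewrite gE // patchE mem_set.
rewrite /facet_integral (@eq_Rintegral _ _ _ _ _ (fun=> 0)).
  by rewrite /Rintegral integral0 mulr0.
have KwT := facets_mem KT wK; move=> t.
rewrite inE => /(facet_param_open pos (facet_card KwT)) Ft.
rewrite patchE memNset ?mulr0 // => F't.
have := facet_disjoint KwT FT Ft F't; rewrite FE => /setP/(_ w).
by rewrite !inE eqxx wK wv.
Qed.

Lemma facet_integral_away F K (p : mpoly m.+1 R) : F \in facets T ->
  K \in T -> ~~ (F \subset K) ->
  \sum_(w in K) facet_integral pos (K :\ w) (fun x =>
      dot (element_trace pos K B x - Bhat x) (n K w) *
      (polyfun p \_ (open_simplex pos F)) x) = 0.
Proof.
move=> FT KT FK; rewrite big1 // => w wK; have KwT := facets_mem KT wK.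
rewrite /facet_integral (@eq_Rintegral _ _ _ _ _ (fun=> 0)).
  by rewrite /Rintegral integral0 mulr0.
move=> t; rewrite inE => /(facet_param_open pos (facet_card KwT)) Ft.
rewrite patchE memNset ?mulr0 // => F't.
by move/negP: FK; apply; rewrite -(facet_disjoint KwT FT Ft F't) finset.subsetDl.
Qed.

Lemma boundary_trace F K v x : boundary_facet pos Omega T F ->
  K \in T -> v \in K -> F = K :\ v -> open_simplex pos F x ->
  dot (element_trace pos K B x) (n K v) = dot (Bhat x) (n K v).
Proof.
move=> bF KT vK FE Fx; have FT := bF.1.
have [g gk gE] := normal_trace_polyfun KT vK; rewrite -FE in gE.
have FK : F \subset K by rewrite FE finset.subsetDl.
have /eqP/cards1P[K1 TF] := mesh_boundary_facet hT bF.
have KK1 : K = K1.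
  have : K \in [set K0 in T | F \subset K0]%SET by rewrite inE KT.
  by rewrite TF inE => /eqP.
suff : polyfun g x = 0.
  by rewrite -gE // dotDl dotNl => /eqP; rewrite subr_eq0 => /eqP.
apply: (facet_polyfun_eq0 FT) Fx.
rewrite -(facet_integral_restrict g KT vK FE gE).
(* The zero on the right is expanded into the tested sum, where only [K] contains [F]. *)
rewrite -[RHS](hjump (Qhat_space_polyfun FT gk)).
rewrite [RHS](bigD1 K) //= [X in _ = _ + X]big1 ?addr0 // => K' /andP[K'T K'K].
apply: facet_integral_away => //; apply/negP => FK'.
have : K' \in [set K0 in T | F \subset K0]%SET by rewrite inE K'T.
by rewrite TF inE -KK1 (negPf K'K).
Qed.

Hypothesis hn : forall K v, K \in T -> v \in K ->
  outward_unit_normal pos K v (n K v).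

Lemma interior_jump F K v K' v' x : interior_facet pos Omega T F ->
  K \in T -> v \in K -> F = K :\ v ->
  K' \in T -> v' \in K' -> F = K' :\ v' -> K != K' ->
  open_simplex pos F x -> normal_jump pos n B K v K' v' x = 0.
Proof.
move=> iF KT vK FE K'T v'K' FE' KK' Fx; have FT := iF.1.
have [g gk gE] := normal_trace_polyfun KT vK; rewrite -FE in gE.
have [g' gk' gE'] := normal_trace_polyfun K'T v'K'; rewrite -FE' in gE'.
have FK : F \subset K by rewrite FE finset.subsetDl.
have FK' : F \subset K' by rewrite FE' finset.subsetDl.
(* Exactly two elements contain [F], so the inclusion of [K] and [K'] is an equality by
   cardinality. *)
have TF : [set K0 in T | F \subset K0]%SET = [set K; K']%SET.
  apply/esym/eqP; rewrite eqEcard (mesh_interior_facet hT iF) cards2 KK' leqnn.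
  by rewrite andbT; apply/fintype.subsetP => K0; rewrite !inE => /orP[]/eqP ->;
    rewrite ?KT ?K'T.
have n'E : n K' v' = - n K v.
  have Fx' := Fx; rewrite FE in Fx'.
  apply: (opposite_normals hT KT K'T KK' vK v'K' _ (hn KT vK) (hn K'T v'K') Fx').
  by rewrite -FE -FE'.
suff : polyfun (g + g') x = 0.
  rewrite polyfunD -gE // -gE' // /normal_jump n'E !dotNr !dotDl !dotNl.
  by rewrite opprD addrACA opprK addNr addr0.
apply: (facet_polyfun_eq0 FT) Fx.
have gg'k : (msize (g + g') <= k.+1)%N.
  by apply: (leq_trans (msizeD_le _ _)); rewrite geq_max gk gk'.
rewrite -[RHS](hjump (Qhat_space_polyfun FT gg'k)).
rewrite [RHS](bigD1 K) //= [X in _ = _ + X](bigD1 K') /=; last first.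
  by rewrite K'T eq_sym.
rewrite [X in _ = _ + (_ + X)]big1 => [|K0 /andP[/andP[K0T K0K] K0K']]; last first.
  apply: facet_integral_away => //; apply/negP => FK0.
  have : K0 \in [set K0 in T | F \subset K0]%SET by rewrite inE K0T.
  by rewrite TF !inE (negPf K0K) (negPf K0K').
rewrite [X in _ = _ + X]addr0.
rewrite [X in _ = X + _](facet_integral_restrict (g + g') KT vK FE gE).
rewrite [X in _ = _ + X](facet_integral_restrict (g + g') K'T v'K' FE' gE').
(* Both elements share the area factor, and [g * (g + g') + g' * (g + g')] is the required
   square. *)
rewrite -[RHS]mulrDr; congr (_ * _).
rewrite -RintegralD.
- by apply: eq_Rintegral => t _; rewrite -mulrDl; congr (_ * _); rewrite polyfunD.
- exact: measurable_reference_simplex.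
- exact: integrable_facet.
- exact: integrable_facet.
Qed.

End facets.

Theorem proposition3 (R : realType) (d : nat) (hd : d = 2%N \/ d = 3%N)
    (Omega : set 'rV[R]_d) (hOmega : bounded_domain Omega)
    (V : finType) (pos : V -> 'rV[R]_d) (T : {set {set V}})
    (hT : triangulation pos Omega T)
    (n : {set V} -> V -> 'rV[R]_d)
    (hn : forall K v, K \in T -> v \in K -> outward_unit_normal pos K v (n K v))
    (k : nat) (hk : (1 <= k)%N)
    (B Bhat : 'rV[R]_d -> 'rV[R]_d)
    (hB : W_space pos Omega T k B) (hBhat : What_space pos T k Bhat)
    (hdiv : forall q : 'rV[R]_d -> R, Q_space pos Omega T k q ->
      \sum_(K in T)
        \int[lebesgue_rV d]_(x in open_simplex pos K) (q x * divergence B x) = 0)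
    (hjump : forall qhat : 'rV[R]_d -> R, Qhat_space pos T k qhat ->
      \sum_(K in T) \sum_(v in K)
        facet_integral pos (K :\ v) (fun x =>
          dot (element_trace pos K B x - Bhat x) (n K v) * qhat x) = 0) :
  [/\ forall K x, K \in T -> open_simplex pos K x -> divergence B x = 0,
      forall F K v K' v' x, interior_facet pos Omega T F ->
        K \in T -> v \in K -> F = K :\ v ->
        K' \in T -> v' \in K' -> F = K' :\ v' -> K != K' ->
        open_simplex pos F x -> normal_jump pos n B K v K' v' x = 0
    & forall F K v x, boundary_facet pos Omega T F ->
        K \in T -> v \in K -> F = K :\ v ->
        open_simplex pos F x ->
        dot (element_trace pos K B x) (n K v) = dot (Bhat x) (n K v)].
Proof.
(* With [d = m.+1], [d.-1] reduces to [m], the form of the facet lemmas; [hd] excludes [d = 0]. *)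
case: d hd Omega hOmega pos hT n hn B Bhat hB hBhat hdiv hjump => [|m].
  by case.
move=> _ {}Omega _ {}pos {}hT {}n {}hn {}B {}Bhat {}hB {}hBhat {}hdiv {}hjump.
split.
- exact: (divergence_eq0 hT hk hB hdiv).
- exact: (interior_jump hT hB hBhat hjump hn).
- exact: (boundary_trace hT hB hBhat hjump).
Qed.
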